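(* Let $\Sigma$ be a finite alphabet with at least two letters, and let $n\ge 2$ and $k\ge 1$ be integers. Let $(L_1,R_1)$ be a partition of $\Sigma$ into two non-empty parts, and for every $i\in\{2,\dots,n-1\}$ let $(L_i,R_i)$ be a partition of $\bigcup_{j=1}^{i-1}L_jR_{i-j}$ into two disjoint, possibly empty, parts. Then $$C=\bigcup_{\substack{i,j\in\{1,\dots,n-1\}\\ n\le i+j\le n+k}}L_iR_j\Sigma^{n+k-i-j}\subseteq\Sigma^{n+k}$$ is a $(k+1)$-weakly mutually uncorrelated code of length $n+k$.
   Context: For sets of words $L,R$, $LR$ denotes the set of all concatenations $lr$ with $l\in L$, $r\in R$; $\Sigma^m$ is the set of all words of length $m$ over $\Sigma$. Two (not necessarily distinct) words $u,v$ have a $t$-overlap if the prefix of $u$ of length $t$ equals the suffix of $v$ of length $t$, or vice versa. A code $C\subseteq\Sigma^N$ is $(t_1,t_2)$-overlap-free if for all $t_1\le t\le t_2$ no two (not necessarily distinct) codewords have a $t$-overlap. A code of length $N$ is $\kappa$-weakly mutually uncorrelated if it is $(\kappa,N-1)$-overlap-free. *)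

(* Defs.v *)
From mathcomp Require Import all_boot.
From mathcomp Require Import boolp classical_sets.

Set Implicit Arguments.
Unset Strict Implicit.
Unset Printing Implicit Defensive.

Local Open Scope classical_set_scope.

Section Codes.
Variable Sigma : finType.
Implicit Types (u v w : seq Sigma) (A B L R C : set (seq Sigma)).

Definition words (m : nat) : set (seq Sigma) := [set w | size w = m].

Definition concat L R : set (seq Sigma) := [set l ++ r | l in L & r in R].

(* The two parts may be empty; non-emptiness is asked for separately. *)
Definition is_bipartition A B (X : set (seq Sigma)) : Prop :=
  A `|` B = X /\ A `&` B = set0.

(* The witness [w] is the common factor; in particular an overlap of length
   [t] requires both words to have length at least [t]. *)
Definition has_overlap (t : nat) u v : Prop :=
  exists w, size w = t /\
    ((prefix w u && suffix w v) || (prefix w v && suffix w u)).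

Definition overlap_free (t1 t2 : nat) C : Prop :=
  forall t, t1 <= t <= t2 -> forall u v, C u -> C v -> ~ has_overlap t u v.

Definition weakly_mutually_uncorrelated (kappa N : nat) C : Prop :=
  C `<=` words N /\ overlap_free kappa N.-1 C.

(* Only the indices 1, ..., n - 1 of the families [L] and [R] are used. *)
Definition code_of (n k : nat) (L R : nat -> set (seq Sigma)) :
    set (seq Sigma) :=
  \bigcup_(ij in [set ij : nat * nat |
      [/\ 1 <= ij.1 <= n - 1, 1 <= ij.2 <= n - 1
        & n <= ij.1 + ij.2 <= n + k]])
    concat (concat (L ij.1) (R ij.2)) (words (n + k - ij.1 - ij.2)).

End Codes.

Arguments words : clear implicits.

(* Main.v *)
Require Import Defs.
From mathcomp Require Import all_boot.
From mathcomp Require Import boolp classical_sets.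
From mathcomp Require Import zify.

(**
Call a word a product if it lies in some [L_i R_j].  Every nonempty proper
suffix of a product begins with a word of some [R_m], and every nonempty proper
prefix ends with a word of some [L_m]; since the [L_i] and [R_i] are disjoint,
a word of [R] never ends with a word of [L].  If a word [w] of length between
[k + 1] and [n + k - 1] is a suffix of the codeword [l' r' s'], deleting [s']
from [w] leaves a nonempty proper suffix of [l' r'], so [w] begins with some
[r1] in [R].  If [w] is also a prefix of [l r s], then [r1], being shorter than
[n], is a proper prefix of [l r], hence ends with a word of [L]: a
contradiction.
*)

Local Open Scope classical_set_scope.

Section SplitSystem.
Variables (T : eqType) (P Q : seq T -> Prop).

Definition product (w : seq T) : Prop :=
  exists l r, [/\ P l, Q r & w = l ++ r].

Hypothesis PQ_gt0 : forall w, P w \/ Q w -> 0 < size w.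
Hypothesis PQ_product : forall w, P w \/ Q w -> 1 < size w -> product w.
Hypothesis PQ_disjoint : forall w, P w -> Q w -> False.

(** Induction on the length, by the place of the cut in [l ++ r]. At the border, [r] itself is what
    remains; strictly inside a factor, that factor has length at least 2, so [PQ_product] makes it a
    shorter product. *)
Lemma product_drop w d : product w -> 0 < d < size w ->
  exists2 r, Q r & prefix r (drop d w).
Proof.
elim: {w}(size w) {-2}w (leqnn (size w)) d => [|N IH] w; first by lia.
move=> sw d [l [r [Pl Qr wE]]]; subst w => hd.
have l0 := PQ_gt0 l (or_introl Pl); have r0 := PQ_gt0 r (or_intror Qr).
rewrite size_cat in sw hd; rewrite drop_cat.
case: ltnP => hdl.
  have [|||r' Qr' pr'] := IH l _ d; [lia| |lia|].
    by apply: PQ_product; [left|lia].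
  by exists r' => //; apply: prefix_trans pr' (prefix_prefix _ _).
have [e0|e0] := posnP (d - size l).
  by exists r => //; rewrite e0 drop0 prefix_refl.
by apply: IH; [lia|apply: PQ_product; [right|lia]|lia].
Qed.

Lemma product_take w d : product w -> 0 < d < size w ->
  exists2 l, P l & suffix l (take d w).
Proof.
elim: {w}(size w) {-2}w (leqnn (size w)) d => [|N IH] w; first by lia.
move=> sw d [l [r [Pl Qr wE]]]; subst w => hd.
have l0 := PQ_gt0 l (or_introl Pl); have r0 := PQ_gt0 r (or_intror Qr).
rewrite size_cat in sw hd; rewrite take_cat.
case: ltnP => hdl.
  by apply: IH; [lia|apply: PQ_product; [left|lia]|lia].
have [e0|e0] := posnP (d - size l).
  by exists l => //; rewrite e0 take0 cats0 suffix_refl.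
have [|||l' Pl' sl'] := IH r _ (d - size l); [lia| |lia|].
  by apply: PQ_product; [right|lia].
by exists l' => //; apply: suffix_trans sl' (suffix_suffix _ _).
Qed.

(** Each half feeds on the other, hence one induction on the total length. If [r] is a proper prefix
    of [l], then [product_take] yields a word [l'] of [P] that is a suffix of [r] and shorter than
    [l]; the other half is dual. Equality is excluded by [PQ_disjoint]. *)
Lemma split_system_incompatible l r :
  P l -> Q r -> ~ prefix r l /\ ~ suffix l r.
Proof.
elim: {l r}(size l + size r) {-2}l {-2}r (leqnn (size l + size r)) => [|N IH] l r sz Pl Qr.
  by have := PQ_gt0 l (or_introl Pl); lia.
have l0 := PQ_gt0 l (or_introl Pl); have r0 := PQ_gt0 r (or_intror Qr).
split=> h.
- move: (h) => /prefixP[s lE].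
  have [s0|s0] := posnP (size s).
    by move: lE; rewrite (size0nil s0) cats0 => lE; apply: (@PQ_disjoint l); rewrite // lE.
  have szl : size l = size r + size s by rewrite lE size_cat.
  have [||l' Pl' sl'] := product_take l (size r); [|lia|].
    by apply: PQ_product; [left|lia].
  move: sl'; rewrite {1}lE take_size_cat // => sl'.
  by have [|_] := IH l' r _ Pl' Qr; [move: (size_suffix sl'); lia|].
- move: (h) => /suffixP[s rE].
  have [s0|s0] := posnP (size s).
    by move: rE; rewrite (size0nil s0) /= => rE; apply: (@PQ_disjoint l); rewrite // -rE.
  have szr : size r = size s + size l by rewrite rE size_cat.
  have [||r' Qr' pr'] := product_drop r (size s); [|lia|].
    by apply: PQ_product; [right|lia].
  move: pr'; rewrite {1}rE drop_size_cat // => pr'.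
  by have [|+ _] := IH l r' _ Pl Qr'; [move: (size_prefix pr'); lia|].
Qed.

Lemma product_no_overlap n u v s s' w :
    (forall r, Q r -> size r < n) -> n <= size u ->
    product u -> product v ->
    size s' < size w < size v + size s' ->
  prefix w (u ++ s) -> suffix w (v ++ s') -> False.
Proof.
move=> Qn nu pu pv hw /prefixP[p uE] /suffixP[q vE].
have sz := congr1 size vE; rewrite !size_cat in sz.
(* Here [q] is what precedes [w] in [v ++ s']; the bounds on [size w] say exactly that this cut
   falls strictly inside [v]. *)
have [|r Qr pr] := product_drop v (size q) pv; first by lia.
have r0 := PQ_gt0 r (or_intror Qr); have rn := Qn r Qr.
(* The cut falls strictly inside [u] because [size r < n <= size u]. *)
have [|l Pl sl] := product_take u (size r) pu; first by lia.
have prw : prefix r w.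
  have -> : w = drop (size q) v ++ s'.
    have := congr1 (drop (size q)) vE.
    rewrite [in RHS]drop_size_cat // drop_cat ifT; [by move=> ->|lia].
  exact: prefix_trans pr (prefix_prefix _ _).
have [_] := split_system_incompatible l r Pl Qr; apply.
suff -> : r = take (size r) u by [].
have : prefix r (u ++ s) by rewrite uE (prefix_trans prw) // prefix_prefix.
by rewrite prefixE take_cat ifT ?(leq_trans rn) // => /eqP.
Qed.

End SplitSystem.

Section BipartitionFamily.
Variables (Sigma : finType) (n : nat) (L R : nat -> set (seq Sigma)).
Hypothesis LR1 : is_bipartition (L 1) (R 1) (words Sigma 1).
Hypothesis LR : forall i, 2 <= i <= n - 1 ->
  is_bipartition (L i) (R i)
    (\bigcup_(j in [set j | 1 <= j <= i - 1]) concat (L j) (R (i - j))).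

(** Forgetting the index turns the two families into the predicates [P] and [Q] of the abstract
    system. *)
Definition family_word (X : nat -> set (seq Sigma)) (w : seq Sigma) : Prop :=
  exists2 i, 1 <= i <= n - 1 & X i w.

(** Strong induction, since [j + (i - j) = i]. A word thus determines its index. *)
Lemma bipartition_size i w : 1 <= i <= n - 1 -> L i w \/ R i w -> size w = i.
Proof.
elim/ltn_ind: i w => i IH w hi hw.
have [i1|i1] : i = 1 \/ 2 <= i by lia.
  by subst i; case: LR1 => E _; have : (L 1 `|` R 1) w by []; rewrite E.
have [|E _] := LR i; first by lia.
have : (L i `|` R i) w by [].
rewrite E => -[j /= hj [l Ll [r Rr <-]]].
by rewrite size_cat (IH j) ?(IH (i - j)) //; [lia..|right|lia|lia|left].
Qed.

Lemma family_word_size w : family_word L w \/ family_word R w -> 0 < size w < n.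
Proof.
by case=> -[i hi wi]; rewrite (bipartition_size i); [lia|by []|auto|lia|by []|auto].
Qed.

Lemma family_word_product w : family_word L w \/ family_word R w ->
  1 < size w -> product _ (family_word L) (family_word R) w.
Proof.
move=> hw sw.
have [i hi wi] : exists2 i, 1 <= i <= n - 1 & L i w \/ R i w.
  by case: hw => -[i hi wi]; exists i; auto.
(* The index equals the length, so it is at least 2 and the recursive bipartition applies. *)
have szi := bipartition_size i w hi wi.
have [|E _] := LR i; first by lia.
have : (L i `|` R i) w by [].
rewrite E => -[j /= hj [l Ll [r Rr <-]]].
by exists l, r; split=> //; [exists j; first lia|exists (i - j); first lia].
Qed.

(** Both indices equal the length of [w], so only disjointness within a single bipartition is at
    stake. *)
Lemma family_word_disjoint w : family_word L w -> family_word R w -> False.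
Proof.
move=> [i hi Li] [j hj Rj].
have := bipartition_size i w hi (or_introl Li).
rewrite (bipartition_size j w hj (or_intror Rj)) => ij; subst j.
have [i1|i1] : i = 1 \/ 2 <= i by lia.
  by subst i; case: LR1 => _ E; have : (L 1 `&` R 1) w by []; rewrite E.
have [|_ E] := LR i; first by lia.
by have : (L i `&` R i) w by []; rewrite E.
Qed.

Lemma code_of_product k w : code_of n k L R w ->
  exists u s, [/\ w = u ++ s, product _ (family_word L) (family_word R) u,
    n <= size u, size s <= k & size u + size s = n + k].
Proof.
move=> [[i j] /= [hi hj hij] [_ [l Ll [r Rr <-]] [s ss <-]]].
rewrite /words /= in ss.
have sl := bipartition_size i l hi (or_introl Ll).
have sr := bipartition_size j r hj (or_intror Rr).
(* The condition [n <= i + j <= n + k] gives both length bounds and keeps the subtraction in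
   [size s] from truncating. *)
exists (l ++ r), s; rewrite size_cat; split=> //; try lia.
by exists l, r; split=> //; [exists i|exists j].
Qed.

Lemma code_of_no_overlap k u v w : code_of n k L R u -> code_of n k L R v ->
  k < size w < n + k -> prefix w u -> suffix w v -> False.
Proof.
move=> /code_of_product[u1 [s [-> pu nu _ _]]].
move=> /code_of_product[v1 [s' [-> pv _ s'k szv]]] hw.
apply: (product_no_overlap _ (family_word L) (family_word R) _ _ _ n) => //.
- by move=> x /family_word_size /andP[].
- exact: family_word_product.
- exact: family_word_disjoint.
- by move=> r Qr; have /andP[] := family_word_size r (or_intror Qr).
(* The tail [s'] has length at most [k], so an overlap longer than [k] reaches into [v1]. *)
- by rewrite szv; case/andP: hw => kw ->; rewrite (leq_ltn_trans s'k kw).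
Qed.

End BipartitionFamily.

Theorem mainTheorem7 (Sigma : finType) (n k : nat)
    (L R : nat -> set (seq Sigma))
    (hSigma : 2 <= #|Sigma|) (hn : 2 <= n) (hk : 1 <= k)
    (hLR1 : is_bipartition (L 1) (R 1) (words Sigma 1))
    (hL1 : L 1 !=set0) (hR1 : R 1 !=set0)
    (hLR : forall i, 2 <= i <= n - 1 ->
       is_bipartition (L i) (R i)
         (\bigcup_(j in [set j | 1 <= j <= i - 1]) concat (L j) (R (i - j)))) :
  weakly_mutually_uncorrelated (k + 1) (n + k) (code_of n k L R).
Proof.
split=> [w|t ht u v Cu Cv [w [sw]]].
  by move=> /(code_of_product _ _ _ _ hLR1 hLR)[u [s [-> _ _ _ szw]]]; rewrite /words /= size_cat.
have hw : k < size w < n + k by lia.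
by case/orP=> /andP[]; [apply: (code_of_no_overlap _ _ _ _ hLR1 hLR k u v)
  |apply: (code_of_no_overlap _ _ _ _ hLR1 hLR k v u)].
Qed.
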